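(* Let $\Sigma$ be the signature of commutative rings with unit extended by a unary inverse operation symbol ${}^{-1}$. A $\Sigma$-structure is a non-trivial meadow if and only if it is (up to isomorphism) a $\Sigma$-substructure of a product of zero totalized fields.
   Context: $\Sigma$ has constants $0,1$, binary operations $+,\cdot$, and unary operations $-$ and ${}^{-1}$; all operations are total. A meadow is a $\Sigma$-structure that is a commutative ring with unit and satisfies $(x^{-1})^{-1}=x$ and $x\cdot(x\cdot x^{-1})=x$ for all $x$. A meadow is non-trivial if $0\neq 1$ in it. A zero totalized field is a $\Sigma$-structure that is a commutative ring with unit in which $0\neq 1$, $x\cdot x^{-1}=1$ for all $x\neq 0$, and $0^{-1}=0$. In a product of zero totalized fields the operations are defined coordinatewise. A $\Sigma$-substructure is a subset containing $0,1$ and closed under $+,-,\cdot,{}^{-1}$, with the restricted operations. *)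

(* Defs.v *)
From Stdlib Require Import Ring_theory.
From Corelib Require ssrfun.

Record sigma_structure : Type := SigmaStructure {
  carrier :> Type;
  zero : carrier;
  one : carrier;
  add : carrier -> carrier -> carrier;
  mul : carrier -> carrier -> carrier;
  opp : carrier -> carrier;
  inv : carrier -> carrier
}.

Arguments zero {s}.
Arguments one {s}.
Arguments add {s} x y.
Arguments mul {s} x y.
Arguments opp {s} x.
Arguments inv {s} x.

Declare Scope sigma_scope.
Delimit Scope sigma_scope with sigma.
Notation "0" := zero : sigma_scope.
Notation "1" := one : sigma_scope.
Notation "x + y" := (add x y) : sigma_scope.
Notation "x * y" := (mul x y) : sigma_scope.
Notation "- x" := (opp x) : sigma_scope.
Notation "x ^-1" := (inv x) (at level 1, left associativity, format "x ^-1")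
  : sigma_scope.
Local Open Scope sigma_scope.

(* [ring_theory] also asks for a subtraction, which is not in the signature;
   it is given here by its usual definition. [ring_theory] allows 0 = 1. *)
Definition is_comm_ring (A : sigma_structure) : Prop :=
  ring_theory (R := A) 0 1 add mul (fun x y => x + - y) opp eq.

Definition is_meadow (A : sigma_structure) : Prop :=
  is_comm_ring A /\
  (forall x : A, (x^-1)^-1 = x) /\
  (forall x : A, x * (x * x^-1) = x).

Definition is_nontrivial (A : sigma_structure) : Prop := (0 : A) <> 1.

Definition is_zero_totalized_field (A : sigma_structure) : Prop :=
  is_comm_ring A /\
  (0 : A) <> 1 /\
  (forall x : A, x <> 0 -> x * x^-1 = 1) /\
  (0 : A)^-1 = 0.

Definition product (I : Type) (F : I -> sigma_structure) : sigma_structure := {|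
  carrier := forall i : I, F i;
  zero := fun i => 0;
  one := fun i => 1;
  add := fun x y i => x i + y i;
  mul := fun x y i => x i * y i;
  opp := fun x i => - x i;
  inv := fun x i => (x i)^-1
|}.

Record substructure (A : sigma_structure) : Type := Substructure {
  member :> A -> Prop;
  member_zero : member 0;
  member_one : member 1;
  member_add : forall x y : A, member x -> member y -> member (x + y);
  member_mul : forall x y : A, member x -> member y -> member (x * y);
  member_opp : forall x : A, member x -> member (- x);
  member_inv : forall x : A, member x -> member (x^-1)
}.

Arguments member {A} s x.
Arguments member_zero {A} s.
Arguments member_one {A} s.
Arguments member_add {A} s {x y} hx hy.
Arguments member_mul {A} s {x y} hx hy.
Arguments member_opp {A} s {x} hx.
Arguments member_inv {A} s {x} hx.

Definition restrict {A : sigma_structure} (S : substructure A)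
  : sigma_structure := {|
  carrier := {x : A | S x};
  zero := exist _ 0 (member_zero S);
  one := exist _ 1 (member_one S);
  add := fun x y => exist _ (proj1_sig x + proj1_sig y)
                      (member_add S (proj2_sig x) (proj2_sig y));
  mul := fun x y => exist _ (proj1_sig x * proj1_sig y)
                      (member_mul S (proj2_sig x) (proj2_sig y));
  opp := fun x => exist _ (- proj1_sig x) (member_opp S (proj2_sig x));
  inv := fun x => exist _ ((proj1_sig x)^-1) (member_inv S (proj2_sig x))
|}.

Definition is_hom {A B : sigma_structure} (f : A -> B) : Prop :=
  f 0 = 0 /\
  f 1 = 1 /\
  (forall x y : A, f (x + y) = f x + f y) /\
  (forall x y : A, f (x * y) = f x * f y) /\
  (forall x : A, f (- x) = - f x) /\
  (forall x : A, f (x^-1) = (f x)^-1).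

Definition isomorphic (A B : sigma_structure) : Prop :=
  exists f : A -> B, is_hom f /\ ssrfun.bijective f.

(* The index type must be inhabited: the empty product is the one-element
   structure, in which 0 = 1. *)
Definition is_substructure_of_product_of_fields (A : sigma_structure) : Prop :=
  exists (I : Type) (F : I -> sigma_structure),
    inhabited I /\
    (forall i : I, is_zero_totalized_field (F i)) /\
    exists S : substructure (product I F), isomorphic A (restrict S).

(* Main.v *)
(* In a meadow, x * x^-1 is idempotent. Hence an ideal P that is maximal among
   those avoiding a given a <> 0 contains x or 1 - x * x^-1 for every x:
   otherwise a = p + r * x and a = q + s * (1 - x * x^-1) with p, q in P, so a^2
   is in P, and so is a = a^2 * a^-1. Inversion is therefore compatible with
   congruence modulo P, and the quotient by P is a zero totalized field in which
   a does not vanish. All these quotients together separate the points of the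
   meadow. Conversely, zero totalized fields are meadows, and the axioms of
   meadows are equations. *)
Require Import Defs.
From mathcomp Require Import ssreflect ssrfun boolp.
From mathcomp Require classical_sets.
From Stdlib Require Import Ring Ring_theory.
Local Open Scope sigma_scope.

Lemma proj1_sig_inj (T : Type) (P : T -> Prop) : injective (@proj1_sig T P).
Proof. by move=> [x px] [y py] /= E; apply: eq_exist. Qed.

(** The ring axioms are equations: each instance in [B] lifts along [f] to an instance in [A]. *)
Lemma comm_ring_of_surjective_hom (A B : sigma_structure) (f : A -> B) :
  is_hom f -> (forall u, exists x, f x = u) -> is_comm_ring A -> is_comm_ring B.
Proof.
move=> [h0 [h1 [hD [hM [hN _]]]]] surjf.
by case=> *; split;
  repeat (let u := fresh in move=> u; have [? <-] := surjf u);
  rewrite -?h0 -?h1 -?(hD, hM, hN); congr f; auto.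
Qed.

(** * Quotients by congruences *)

Section CongruenceQuotient.

Record congruence (A : sigma_structure) : Type := Congruence {
  congr_rel :> A -> A -> Prop;
  congr_refl : forall x, congr_rel x x;
  congr_sym : forall x y, congr_rel x y -> congr_rel y x;
  congr_trans : forall x y z, congr_rel x y -> congr_rel y z -> congr_rel x z;
  congr_add : forall x x' y y',
    congr_rel x x' -> congr_rel y y' -> congr_rel (x + y) (x' + y');
  congr_mul : forall x x' y y',
    congr_rel x x' -> congr_rel y y' -> congr_rel (x * y) (x' * y');
  congr_opp : forall x x', congr_rel x x' -> congr_rel (- x) (- x');
  congr_inv : forall x x', congr_rel x x' -> congr_rel (x^-1) (x'^-1)
}.

Variables (A : sigma_structure) (R : congruence A).

(** A class is the predicate [R x] itself, so that by extensionality congruent elements have equal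
    classes. *)
Definition quotient_carrier : Type := {C : A -> Prop | exists x, C = R x}.

Definition class (x : A) : quotient_carrier :=
  exist _ (R x) (ex_intro _ x erefl).

Definition repr (u : quotient_carrier) : A := projT1 (cid (proj2_sig u)).

Lemma classP (x y : A) : class x = class y <-> R x y.
Proof.
split=> [E|Rxy].
  have -> : R x y = R y y by rewrite (f_equal (@proj1_sig _ _) E : R x = R y).
  exact: congr_refl.
apply: proj1_sig_inj; apply: funext => z; apply: propext; split=> H.
  exact: congr_trans (congr_sym _ _ _ _ Rxy) H.
exact: congr_trans Rxy H.
Qed.

Lemma reprK (u : quotient_carrier) : class (repr u) = u.
Proof. by apply: proj1_sig_inj; rewrite /repr; case: cid. Qed.

Lemma repr_class (x : A) : R (repr (class x)) x.
Proof. by apply/classP; rewrite reprK. Qed.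

Definition quotient : sigma_structure := {|
  carrier := quotient_carrier;
  zero := class 0;
  one := class 1;
  add := fun u v => class (repr u + repr v);
  mul := fun u v => class (repr u * repr v);
  opp := fun u => class (- repr u);
  inv := fun u => class ((repr u)^-1)
|}.

Lemma class_is_hom : is_hom (class : A -> quotient).
Proof.
do 2!split=> //; do !split; move=> *; apply/classP; apply: congr_sym.
- by apply: congr_add; apply: repr_class.
- by apply: congr_mul; apply: repr_class.
- by apply: congr_opp; apply: repr_class.
- by apply: congr_inv; apply: repr_class.
Qed.

Lemma quotient_comm_ring : is_comm_ring A -> is_comm_ring quotient.
Proof.
move=> ringA; apply: (comm_ring_of_surjective_hom A quotient class) => //.
  exact: class_is_hom.
by move=> u; exists (repr u); apply: reprK.
Qed.

End CongruenceQuotient.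

(** * Ideals of a meadow *)

Record is_ideal (A : sigma_structure) (P : A -> Prop) : Prop := IsIdeal {
  ideal_zero : P 0;
  ideal_add : forall x y, P x -> P y -> P (x + y);
  ideal_mul : forall r x, P x -> P (r * x)
}.

(** In a meadow these are exactly the prime ideals; the disjunction says that [x] is zero or
    invertible modulo [P]. *)
Definition is_pseudoprime {A : sigma_structure} (P : A -> Prop) : Prop :=
  is_ideal A P /\ ~ P 1 /\ forall x, P x \/ P (1 + - (x * x^-1)).

Section Meadow.

Variable A : sigma_structure.
Hypothesis meadowA : is_meadow A.

Let ringA : is_comm_ring A := proj1 meadowA.
Let invK : forall x : A, (x^-1)^-1 = x := proj1 (proj2 meadowA).
Let mulKV : forall x : A, x * (x * x^-1) = x := proj2 (proj2 meadowA).

Add Ring ring_of_meadow : (ringA : ring_theory _ _ _ _ _ _ _).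

Lemma inv_mulKV (x : A) : x^-1 * (x^-1 * x) = x^-1.
Proof. by have := mulKV (x^-1); rewrite invK. Qed.

Lemma eq_of_sub_eq0 (x y : A) : x + - y = 0 -> x = y.
Proof.
by move=> E; have -> : x = (x + - y) + y by [ring]; rewrite E; ring.
Qed.

Lemma exists_maximal_ideal (a : A) : a <> 0 ->
  exists P : A -> Prop, is_ideal A P /\ ~ P a /\
    forall J, is_ideal A J -> ~ J a -> (forall x, P x -> J x) ->
      forall x, J x -> P x.
Proof.
move=> a0.
(* Closure alone admits the empty set, the union of the empty chain. *)
pose Q (P : A -> Prop) := (forall x y, P x -> P y -> P (x + y)) /\
  (forall r x, P x -> P (r * x)) /\ ~ P a.
have [F QF totF|P [[PD [PM Pa]] Pmax]] := @classical_sets.Zorn_bigcup A Q.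
  split; [|split].
  - move=> x y [X FX Xx] [Y FY Yy].
    (* Both summands lie in the larger of two comparable members of the chain. *)
    case: (totF X Y FX FY) => sub; [exists Y|exists X] => //.
      by apply: (proj1 (QF _ FY)) => //; apply: sub.
    by apply: (proj1 (QF _ FX)) => //; apply: sub.
  - move=> r x [X FX Xx]; exists X => //.
    exact: (proj1 (proj2 (QF _ FX))).
  - move=> [X FX Xa]; exact: (proj2 (proj2 (QF _ FX))) Xa.
exists P; split; last split=> //.
  split=> //; apply: contrapT => P0.
  (* Without 0, [P] would be empty, as [0 = 0 * x]; the zero ideal, which avoids [a], would then be
     strictly larger. *)
  apply: (Pmax (fun x => x = 0)).
    split=> [x Px|sub]; last by apply: P0; apply: sub.
    by case: P0; have -> : 0 = 0 * x by [ring]; apply: PM.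
  by split=> [x y -> ->|]; [ring|split=> // r x ->; ring].
move=> J [J0 JD JM] Ja sub; apply: contrapT => nsub.
by apply: (Pmax J); split=> //.
Qed.

Lemma exists_pseudoprime (a : A) : a <> 0 ->
  exists2 P : A -> Prop, is_pseudoprime P & ~ P a.
Proof.
move=> a0; have [P [idP [Pa Pmax]]] := exists_maximal_ideal a a0.
case: (idP) => P0 PD PM.
(* By maximality, the ideal [J] generated by [P] and an [x] outside [P] contains [a]. *)
have extend x : ~ P x -> exists p r, P p /\ a = p + r * x.
  move=> Px; apply: contrapT => na; apply: Px.
  pose J y := exists p r, P p /\ y = p + r * x.
  apply: (Pmax J) => //.
  - split.
    + by exists 0, 0; split=> //; ring.
    + move=> _ _ [p [r [Pp ->]]] [q [s [Pq ->]]].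
      by exists (p + q), (r + s); split; [exact: PD|ring].
    + move=> t _ [p [r [Pp ->]]].
      by exists (t * p), (t * r); split; [exact: PM|ring].
  - by move=> y Py; exists y, 0; split=> //; ring.
  - by exists 0, 1; split=> //; ring.
exists P => //; split=> //; split=> [P1|x].
  by apply: Pa; have -> : a = a * 1 by [ring]; apply: PM.
case: (EM (P x)) => Px; [by left|right; apply: contrapT => Pe].
have [p [r [Pp Ea]]] := extend _ Px.
have [q [s [Pq Ea']]] := extend _ Pe.
apply: Pa.
have xe : x * (1 + - (x * x^-1)) = 0.
  have -> : x * (1 + - (x * x^-1)) = x + - (x * (x * x^-1)) by ring.
  by rewrite mulKV; ring.
(* Substitute the two expressions for [a] one factor at a time; the term in [r * s] vanishes by
   [xe]. *)
have aa : a * a = a * p + r * x * q.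
  rewrite {2}Ea.
  have -> : a * (p + r * x) = a * p + r * x * a by ring.
  rewrite {2}Ea'.
  have -> : r * x * (q + s * (1 + - (x * x^-1))) =
            r * x * q + r * s * (x * (1 + - (x * x^-1))) by ring.
  by rewrite xe; ring.
have -> : a = a^-1 * (a * a) by rewrite -{1}(mulKV a); ring.
by rewrite aa; apply: (PM); apply: PD; apply: PM.
Qed.

(** * The residue field at a pseudoprime ideal *)

Section Residue.

Variable P : A -> Prop.
Hypothesis pseudoprimeP : is_pseudoprime P.

Let P0 : P 0 := ideal_zero _ _ (proj1 pseudoprimeP).
Let PD := ideal_add _ _ (proj1 pseudoprimeP).
Let PM := ideal_mul _ _ (proj1 pseudoprimeP).

Definition residue_rel (x y : A) : Prop := P (x + - y).

Lemma residue_rel_refl x : residue_rel x x.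
Proof. by rewrite /residue_rel; have -> : x + - x = 0 by ring. Qed.

Lemma residue_rel_sym x y : residue_rel x y -> residue_rel y x.
Proof.
move=> H; rewrite /residue_rel.
(* Negation in an ideal is multiplication by [- (1)]. *)
have -> : y + - x = - (1) * (x + - y) by ring.
exact: PM.
Qed.

Lemma residue_rel_trans x y z :
  residue_rel x y -> residue_rel y z -> residue_rel x z.
Proof.
move=> H K; rewrite /residue_rel.
have -> : x + - z = (x + - y) + (y + - z) by ring.
exact: PD.
Qed.

Lemma residue_rel_add x x' y y' :
  residue_rel x x' -> residue_rel y y' -> residue_rel (x + y) (x' + y').
Proof.
move=> H K; rewrite /residue_rel.
have -> : x + y + - (x' + y') = (x + - x') + (y + - y') by ring.
exact: PD.
Qed.

Lemma residue_rel_mul x x' y y' :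
  residue_rel x x' -> residue_rel y y' -> residue_rel (x * y) (x' * y').
Proof.
move=> H K; rewrite /residue_rel.
have -> : x * y + - (x' * y') = y * (x + - x') + x' * (y + - y') by ring.
by apply: PD; apply: PM.
Qed.

Lemma residue_rel_opp x x' : residue_rel x x' -> residue_rel (- x) (- x').
Proof.
move=> H; rewrite /residue_rel.
have -> : - x + - - x' = - (1) * (x + - x') by ring.
exact: PM.
Qed.

(** By [inv_mulKV], [x^-1] is a multiple of [x]. *)
Lemma ideal_inv x : P x -> P (x^-1).
Proof. by move=> Px; rewrite -inv_mulKV; do 2!apply: PM. Qed.

Lemma residue_rel_inv x y : residue_rel x y -> residue_rel (x^-1) (y^-1).
Proof.
move=> H; have H' := residue_rel_sym _ _ H.
(* If one element lies in [P], so does the other, and both inverses vanish modulo [P]. *)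
have aux u v : residue_rel u v -> P u -> residue_rel (u^-1) (v^-1).
  move=> Ruv Pu; have Pv : P v.
    have -> : v = u + - (1) * (u + - v) by ring.
    by apply: PD => //; apply: PM.
  rewrite /residue_rel; have -> : u^-1 + - v^-1 = u^-1 + - (1) * v^-1 by ring.
  by apply: PD; last apply: PM; apply: ideal_inv.
case: (proj2 (proj2 pseudoprimeP) x) => Px; first exact: aux.
case: (proj2 (proj2 pseudoprimeP) y) => Py.
  by apply: residue_rel_sym; apply: aux.
rewrite /residue_rel.
(* Now [x * x^-1] and [y * y^-1] are both 1 modulo [P], so the difference of the inverses is a
   multiple of [x + - y] up to terms in [P]. *)
have -> : x^-1 + - y^-1 =
    x^-1 * (1 + - (y * y^-1)) +
    (- y^-1 * (1 + - (x * x^-1)) + - (x^-1 * y^-1) * (x + - y)) by ring.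
by apply: PD; last apply: PD; apply: PM.
Qed.

Definition residue_congruence : congruence A :=
  {| congr_rel := residue_rel;
     congr_refl := residue_rel_refl;
     congr_sym := residue_rel_sym;
     congr_trans := residue_rel_trans;
     congr_add := residue_rel_add;
     congr_mul := residue_rel_mul;
     congr_opp := residue_rel_opp;
     congr_inv := residue_rel_inv |}.

Definition residue_field : sigma_structure := quotient A residue_congruence.

Definition residue (x : A) : residue_field := class A residue_congruence x.

Lemma residue_eq0 x : residue x = 0 <-> P x.
Proof.
have E : x + - 0 = x by ring.
by split=> [/classP|Px]; [|apply/classP]; rewrite /= /residue_rel E.
Qed.

Lemma residue_field_is_field : is_zero_totalized_field residue_field.
Proof.
have [h0 [h1 [_ [hM [_ hV]]]]] := class_is_hom A residue_congruence.
split; first exact: quotient_comm_ring.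
split; [|split].
- by move=> /esym E; apply: (proj1 (proj2 pseudoprimeP)); apply/residue_eq0.
- move=> u; rewrite -[u]reprK; set x := repr _ _ u => x0.
  (* The symmetric form of the goal is the second alternative of pseudoprimality; [x0] rules out the
     first. *)
  rewrite -hV -hM -h1; apply/classP; apply: residue_rel_sym.
  by case: (proj2 (proj2 pseudoprimeP) x) => // /residue_eq0 /x0.
- by rewrite -h0 -hV; apply/residue_eq0; apply: ideal_inv.
Qed.

End Residue.

End Meadow.

(** * Meadows from fields, products and embeddings *)

Lemma field_is_meadow (A : sigma_structure) :
  is_zero_totalized_field A -> is_meadow A.
Proof.
move=> [ringA [neq01 [divff inv0]]].
have mul0 := ARmul_0_l (Rth_ARth (Eqsth A) (Eq_ext add mul opp) ringA).
have mulC := Rmul_comm ringA.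
have mul1 := Rmul_1_l ringA.
split=> //; split=> x; case: (EM (x = 0)) => [->|x0].
- by rewrite !inv0.
- have y0 : x^-1 <> 0.
    by move=> y0; apply: neq01; rewrite -(divff x x0) y0 mulC mul0.
  rewrite -[LHS]mul1 -(divff x x0) -(Rmul_assoc ringA) divff //.
  by rewrite mulC mul1.
- by rewrite mul0.
- by rewrite divff // mulC mul1.
Qed.

Lemma product_is_meadow (I : Type) (F : I -> sigma_structure) :
  (forall i, is_meadow (F i)) -> is_meadow (product I F).
Proof.
move=> meadowF; split; [split|split] => *; apply: functional_extensionality_dep => i;
  have [[]] := meadowF i => //= *; firstorder.
Qed.

Lemma meadow_of_injective_hom (A B : sigma_structure) (f : A -> B) :
  is_hom f -> injective f -> is_meadow B -> is_meadow A.
Proof.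
move=> [h0 [h1 [hD [hM [hN hV]]]]] injf [[? ? ? ? ? ? ? ? ?] [VK KV]].
by split; [split|split] => *; apply: injf;
  rewrite ?(hD, hM, hN, hV, h0, h1); auto.
Qed.

Lemma isomorphic_image (A B : sigma_structure) (f : A -> B) :
  is_hom f -> injective f -> exists S : substructure B, isomorphic A (restrict S).
Proof.
move=> [h0 [h1 [hD [hM [hN hV]]]]] injf.
unshelve epose (S := Substructure B (fun u => exists x, f x = u) _ _ _ _ _ _).
- by exists 0.
- by exists 1.
- by move=> _ _ [x <-] [y <-]; exists (x + y).
- by move=> _ _ [x <-] [y <-]; exists (x * y).
- by move=> _ [x <-]; exists (- x).
- by move=> _ [x <-]; exists (x^-1).
pose fS (x : A) : restrict S := exist _ (f x) (ex_intro _ x erefl).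
exists S, fS; split; first by do !split; move=> *; apply: proj1_sig_inj => /=.
exists (fun u : restrict S => projT1 (cid (proj2_sig u))) => [x|u];
  case: cid => y /= fy.
  exact: injf.
exact: proj1_sig_inj.
Qed.

Theorem theorem3p8 (A : sigma_structure) :
  (is_meadow A /\ is_nontrivial A) <-> is_substructure_of_product_of_fields A.
Proof.
split=> [[meadowA nontrivA]|].
  pose I := {P : A -> Prop | is_pseudoprime P}.
  pose F (i : I) := residue_field A meadowA (proj1_sig i) (proj2_sig i).
  pose f (x : A) : product I F := fun i => residue A meadowA _ (proj2_sig i) x.
  have homf : is_hom f.
    by do !split; move=> *; apply: functional_extensionality_dep => i;
      apply (class_is_hom A (residue_congruence A meadowA _ (proj2_sig i))).
  have injf : injective f.
    move=> x y fxy; apply: contrapT => neq_xy.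
    have xy0 : x + - y <> 0.
      by move=> E; apply: neq_xy; apply: eq_of_sub_eq0 E.
    have [P primeP Pxy] := exists_pseudoprime A meadowA _ xy0.
    apply: Pxy.
    have := f_equal (fun u => u (exist _ P primeP)) fxy.
    by move=> /classP.
  exists I, F; split; [|split].
  - have [P primeP _] := exists_pseudoprime A meadowA 1 (nesym nontrivA).
    exact: inhabits (exist _ P primeP).
  - by move=> i; apply: residue_field_is_field.
  - exact: (isomorphic_image A (product I F) f).
move=> [I [F [[i] [fieldF [S [f [homf [g fK gK]]]]]]]]; split.
  apply: (meadow_of_injective_hom A (product I F) (fun x => proj1_sig (f x))).
  - by case: homf => [h0 [h1 [hD [hM [hN hV]]]]];
      do !split; move=> *; rewrite ?(h0, h1, hD, hM, hN, hV).
  - by move=> x y /proj1_sig_inj /(can_inj fK).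
  - by apply: product_is_meadow => j; apply: field_is_meadow.
case: homf => [f0 [f1 _]] E; apply: (proj1 (proj2 (fieldF i))).
have := f_equal (fun x => proj1_sig (f x) i) E.
by rewrite f0 f1.
Qed.
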